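(* Let $G=(V,\mathcal{E})$ be a simple undirected graph with $V=\{1,\dots,n\}$, let $G_S=(V_S,\mathcal{E}_S)$ be an induced subgraph of $G$, and let $V_I,V_O\subseteq V$. Let $A\in\mathbb{R}^{q\times q}$, $B\in\mathbb{R}^{q\times r}$, $C\in\mathbb{R}^{t\times q}$, $E\in\mathbb{R}^{q\times \sigma}$, $K\in\mathbb{R}^{\sigma\times q}$ be real matrices. Define $W:=V_I\cap V_O$ and let $D(W)$ be the derived set of $W$ in $G$. If $V_S\subseteq D(W)$ and $C(EK)^kB\neq 0$ for all integers $k\geq 1$, then $(G_S;V_I;V_O)$ is identifiable with respect to the networked system $$\dot x=(I\otimes A+X\otimes EK)x+(M\otimes B)u,\qquad y=(N\otimes C)x,$$ where $X\in\mathcal{Q}_p(G)$ and $M,N$ are the input and output matrices associated with $V_I,V_O$.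
   Context: All graphs are simple (no self-loops, at most one edge between any pair of vertices) and undirected, with vertex set $V=\{1,\dots,n\}$. A vertex $j$ is a neighbour of $i$ if $(i,j)\in\mathcal{E}$. An induced subgraph $G_S=(V_S,\mathcal{E}_S)$ of $G$ satisfies $V_S\subseteq V$ and, for all $i,j\in V_S$, $(i,j)\in \mathcal{E}_S$ if and only if $(i,j)\in \mathcal{E}$. Matrix class. $\mathcal{Q}_p(G)$ is the set of real symmetric $n\times n$ matrices $X$ such that for all $i\neq j$: $X_{ji}>0$ if $(i,j)\in \mathcal{E}$, and $X_{ji}=0$ if $(i,j)\notin \mathcal{E}$. The diagonal entries of $X$ are arbitrary real numbers. Input/output matrices. For $V'=\{v_1,\dots,v_r\}\subseteq V$, $P(V;V')$ is the $n\times r$ matrix with $P_{ij}=1$ if $i=v_j$ and $P_{ij}=0$ otherwise. Given input nodes $V_I\subseteq V$ and output nodes $V_O\subseteq V$, put $M=P(V;V_I)$ and $N=P(V;V_O)^\top$. Identifiability with respect to the networked system. The matrices $A,B,C,E,K$ are fixed and known; $\otimes$ is the Kronecker product. Put $M_e:=M\otimes B$, $N_e:=N\otimes C$, and for $X,\bar X\in\mathcal{Q}_p(G)$ put $X_e:=I_n\otimes A+X\otimes EK$, $\bar X_e:=I_n\otimes A+\bar X\otimes EK$. $(G_S;V_I;V_O)$ is identifiable with respect to the networked system if for all $X,\bar X\in\mathcal{Q}_p(G)$: whenever $N_e(sI-X_e)^{-1}M_e=N_e(sI-\bar X_e)^{-1}M_e$ (as rational matrices in the complex variable $s$), then $X_S=\bar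 X_S$, where $X_S,\bar X_S$ are the principal submatrices of $X,\bar X$ with rows and columns indexed by $V_S$. Zero forcing. Vertices of $G$ are colored black or white. Color-change rule: if $u$ is a black vertex and exactly one neighbour $v$ of $u$ is white, then change the color of $v$ to black. For $Z\subseteq V$, color the vertices of $Z$ black and those of $V\setminus Z$ white; the derived set $D(Z)$ is the set of black vertices obtained by applying the color-change rule until no more changes are possible. *)

(* Defs.v *)
From HB Require Import structures.
From mathcomp Require Import all_boot all_order all_algebra.
From mathcomp Require Import mxtens reals.

Set Implicit Arguments.
Unset Strict Implicit.
Unset Printing Implicit Defensive.

Import Order.TTheory GRing.Theory Num.Theory.
Local Open Scope ring_scope.

Record sgraph (T : finType) := SGraph {
  edge :> rel T;
  edge_sym : symmetric edge;
  edge_irrefl : irreflexive edge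
}.

Record induced_subgraph (T : finType) (G : sgraph T) := InducedSubgraph {
  sub_vertices : {set T};
  sub_edge : rel {i : T | i \in sub_vertices};
  sub_edgeE : forall i j, sub_edge i j = G (val i) (val j)
}.

(** * Zero forcing: a set of vertices is the set of the black ones *)

Definition forces (T : finType) (G : sgraph T) (Z : {set T}) (u v : T) : bool :=
  (u \in Z) && ([set w | G u w & w \notin Z] == [set v]).

Definition color_change (T : finType) (G : sgraph T) : rel {set T} :=
  fun Z Z' => [exists u, exists v, forces G Z u v && (Z' == v |: Z)].

(* [D] results from [Z] by some run of the color-change rule, in any order of
   application, that cannot be continued; it exists and does not depend on the
   run, see [derived_set_exists] and [derived_set_unique]. *)
Definition is_derived_set (T : finType) (G : sgraph T) (Z D : {set T}) : Prop :=
  connect (color_change G) Z D /\ forall D', ~~ color_change G D D'.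

Lemma derived_set_exists (T : finType) (G : sgraph T) (Z : {set T}) :
  exists D, is_derived_set G Z D.
Proof.
have [m] := ubnP #|~: Z|; elim: m Z => // m IHm Z; rewrite ltnS => leZm.
have [/existsP[Z' ZZ'] | /existsPn stuckZ] :=
  boolP [exists Z', color_change G Z Z']; last by exists Z; split.
have /existsP[u /existsP[v /andP[/andP[_ /eqP Euv] /eqP DZ']]] := ZZ'.
have Zv : v \notin Z.
  by have := set11 v; rewrite -Euv inE => /andP[].
have [|D [ZD stuckD]] := IHm Z'.
  apply: leq_trans leZm; apply: proper_card.
  by rewrite DZ' properC; apply: properUr; rewrite sub1set.
by exists D; split=> //; apply: connect_trans ZD; apply: connect1.
Qed.

Lemma derived_set_unique (T : finType) (G : sgraph T) (Z D1 D2 : {set T}) :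
  is_derived_set G Z D1 -> is_derived_set G Z D2 -> D1 = D2.
Proof.
have subD (Z1 Z2 D : {set T}) : Z1 \subset D -> (forall D', ~~ color_change G D D') ->
    connect (color_change G) Z1 Z2 -> Z2 \subset D.
  move=> sZD stuckD /connectP[p pZ ->] {Z2}.
  elim: p Z1 sZD pZ => //= Z2 p IHp Z1 sZD /andP[step]; apply: IHp.
  have /existsP[u /existsP[v /andP[/andP[uZ /eqP Euv] /eqP ->]]] := step.
  rewrite subUset sZD andbT sub1set; apply/negPn/negP => vD.
  suff : color_change G D (v |: D) by rewrite (negPf (stuckD _)).
  apply/existsP; exists u; apply/existsP; exists v.
  rewrite /forces (subsetP sZD) // eqxx andbT eqEsubset sub1set inE vD !andbT.
  have : v \in [set w | G u w & w \notin Z1] by rewrite Euv set11.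
  rewrite inE => /andP[-> _]; rewrite andbT -Euv; apply/subsetP => w.
  by rewrite !inE => /andP[-> wD] /=; apply: contra wD; apply: subsetP.
have start (Z1 D : {set T}) : connect (color_change G) Z1 D -> Z1 \subset D.
  move=> /connectP[p pZ ->] {D}; elim: p Z1 pZ => //= Z2 p IHp Z1 /andP[step].
  move=> /IHp; apply: subset_trans.
  by have /existsP[u /existsP[v /andP[_ /eqP ->]]] := step; apply: subsetUr.
move=> [ZD1 st1] [ZD2 st2]; apply/eqP; rewrite eqEsubset.
by rewrite (subD Z D1 D2) ?(subD Z D2 D1) // start.
Qed.

(** * Networked systems *)

Definition Qp (R : realType) (n : nat) (G : sgraph 'I_n) (X : 'M[R]_n) : Prop :=
  X^T = X /\
  forall i j, i != j ->
    (G i j -> 0 < X j i) /\ (~~ G i j -> X j i = 0).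

(* The columns follow the increasing enumeration of [V']. *)
Definition Pmx (R : realType) (n : nat) (V' : {set 'I_n}) : 'M[R]_(n, #|V'|) :=
  \matrix_(i, j) (i == enum_val j)%:R.

Definition principal_submx (R : realType) (n : nat) (V' : {set 'I_n})
    (X : 'M[R]_n) : 'M[R]_#|V'| :=
  mxsub (@enum_val _ (mem V')) (@enum_val _ (mem V')) X.

Definition ratfun (R : realType) := {fraction {poly R}}.

Definition ratmx (R : realType) (m p : nat) (Y : 'M[R]_(m, p)) :
    'M[ratfun R]_(m, p) :=
  map_mx (fun a => tofrac a%:P) Y.

(* N (sI - X)^-1 M; the inverse is a genuine one, see [resolvent_unit]. *)
Definition transfer_mx (R : realType) (m p r : nat)
    (N : 'M[R]_(p, m)) (X : 'M[R]_m) (M : 'M[R]_(m, r)) :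
    'M[ratfun R]_(p, r) :=
  let s : ratfun R := tofrac 'X in
  ratmx N *m invmx (s%:M - ratmx X) *m ratmx M.

Lemma resolvent_unit (R : realType) (m : nat) (X : 'M[R]_m) :
  (tofrac 'X)%:M - ratmx X \in unitmx.
Proof.
have -> : (tofrac 'X)%:M - ratmx X = map_mx (@tofrac {poly R}) (char_poly_mx X).
  by apply/matrixP=> i j; rewrite !mxE rmorphB rmorphMn.
rewrite unitmxE unitfE det_map_mx tofrac_eq0.
exact/monic_neq0/char_poly_monic.
Qed.

Definition identifiable (R : realType) (n q r t sigma : nat)
    (A : 'M[R]_q) (B : 'M[R]_(q, r)) (C : 'M[R]_(t, q))
    (E : 'M[R]_(q, sigma)) (K : 'M[R]_(sigma, q))
    (G : sgraph 'I_n) (GS : induced_subgraph G) (VI VO : {set 'I_n}) : Prop :=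
  let Me := Pmx R VI *t B in
  let Ne := (Pmx R VO)^T *t C in
  let ext (X : 'M[R]_n) := 1%:M *t A + X *t (E *m K) in
  forall X Xbar : 'M[R]_n, Qp G X -> Qp G Xbar ->
    transfer_mx Ne (ext X) Me = transfer_mx Ne (ext Xbar) Me ->
    principal_submx (sub_vertices GS) X = principal_submx (sub_vertices GS) Xbar.

(* Main.v *)
(** Expanding the transfer matrix at infinity shows that it determines the
    Markov parameters N_e X_e^k M_e. In (I (x) A + X (x) EK)^k the only term of
    degree k in X is X^k (x) (EK)^k, so, as C (EK)^k B <> 0, an induction on k
    recovers all the N X^k M: the entries of every X^k on V_I :&: V_O are
    determined. This property propagates along a force u -> v: in row u of
    X X^k the only unknown term is X_uv (X^k)_vj; applied with j = u and k = 1
    it gives X_uv^2, hence X_uv by positivity, and then the rest of row and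
    column v of X^k. *)
Require Import Defs.
From mathcomp Require Import all_boot all_order all_algebra.
From mathcomp Require Import reals.
From mathcomp Require Import perm mxtens.
Local Open Scope ring_scope.
Import Order.TTheory GRing.Theory Num.Theory.

Set Implicit Arguments.
Unset Strict Implicit.
Unset Printing Implicit Defensive.

(** * Strict properness of the transfer matrix and its Markov parameters *)

Lemma size_adj_char_poly_mx (F : fieldType) (m : nat) (X : 'M[F]_m) i j :
  (size (\adj (char_poly_mx X) i j) <= m)%N.
Proof.
rewrite mxE expand_cofactor; apply: (leq_trans (size_sum _ _ _)).
apply/bigmax_leqP => s _; rewrite mulr_sign.
have szP : (size (\prod_(k | j != k) char_poly_mx X k (s k))%R <= m)%N.
  apply: (leq_trans (size_poly_prod_leq _ _)).
  have cardP : #|(fun k => j != k)| = m.-1.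
    rewrite -[m in RHS]card_ord -(cardC1 j).
    by apply: eq_card => k; rewrite !inE eq_sym.
  (* The product has m - 1 factors of size at most 2, so its size is at most 2(m - 1) + 1 - (m - 1)
     = m. *)
  rewrite cardP leq_subLR.
  apply: (@leq_ltn_trans (\sum_(k < m | j != k) 2)).
    apply: leq_sum => k _; rewrite !mxE.
    case: eqP => _; first by rewrite mulr1n size_XsubC.
    by rewrite mulr0n sub0r size_polyN (leq_trans (size_polyC_leq1 _)).
  rewrite sum_nat_const cardP.
  by rewrite -[in ltnRHS](ltn_predK (ltn_ord i)) muln2 -addnn addnS.
by case: ifP => _; rewrite ?size_polyN.
Qed.

Lemma size_mulmx_polyC (F : fieldType) (m p q d : nat)
    (P : 'M[{poly F}]_(m, p)) (N : 'M[F]_(p, q)) :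
  (forall i j, size (P i j) <= d)%N ->
  forall i j, (size ((P *m map_mx polyC N) i j) <= d)%N.
Proof.
move=> szP i j; rewrite mxE; apply: (leq_trans (size_sum _ _ _)).
apply/bigmax_leqP => k _; rewrite mxE mulrC mul_polyC.
exact: leq_trans (size_scale_leq _ _) (szP i k).
Qed.

Lemma size_polyC_mulmx (F : fieldType) (m p q d : nat)
    (N : 'M[F]_(m, p)) (P : 'M[{poly F}]_(p, q)) :
  (forall i j, size (P i j) <= d)%N ->
  forall i j, (size ((map_mx polyC N *m P) i j) <= d)%N.
Proof.
move=> szP i j; rewrite mxE; apply: (leq_trans (size_sum _ _ _)).
apply/bigmax_leqP => k _; rewrite mxE mul_polyC.
exact: leq_trans (size_scale_leq _ _) (szP k j).
Qed.

Lemma ratmxE (R : realType) (m p : nat) (Y : 'M[R]_(m, p)) :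
  ratmx Y = map_mx (@tofrac {poly R}) (map_mx polyC Y).
Proof. by apply/matrixP => i j; rewrite !mxE. Qed.

Lemma ratmxM (R : realType) (m p q : nat) (Y : 'M[R]_(m, p)) (Z : 'M[R]_(p, q)) :
  ratmx (Y *m Z) = ratmx Y *m ratmx Z.
Proof. by rewrite !ratmxE !map_mxM. Qed.

(** By Cramer's rule the resolvent is the adjugate over [char_poly X], which has size m + 1; the
    numerators have size at most m. *)
Lemma transfer_mx_strictly_proper (R : realType) (m p r : nat)
    (N : 'M[R]_(p, m)) (X : 'M[R]_m) (M : 'M[R]_(m, r)) :
  exists2 P : 'M[{poly R}]_(p, r),
    tofrac (char_poly X) *: transfer_mx N X M = map_mx (@tofrac {poly R}) P
    & forall i j, (size (P i j) <= m)%N.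
Proof.
exists (map_mx polyC N *m \adj (char_poly_mx X) *m map_mx polyC M); last first.
  apply: size_mulmx_polyC; apply: size_polyC_mulmx.
  exact: size_adj_char_poly_mx.
rewrite /transfer_mx.
have resE : (tofrac 'X)%:M - ratmx X = map_mx (@tofrac {poly R}) (char_poly_mx X).
  by apply/matrixP=> i j; rewrite !mxE rmorphB rmorphMn.
have chi0 : tofrac (char_poly X) != 0.
  by rewrite tofrac_eq0 monic_neq0 // char_poly_monic.
rewrite /invmx resolvent_unit resE det_map_mx -/(char_poly X) -map_mx_adj.
rewrite -scalemxAr -scalemxAl scalerA mulfV // scale1r.
by rewrite !ratmxE !map_mxM.
Qed.

(** One step of the expansion at infinity, from s (sI - X)^-1 = I + X (sI - X)^-1. *)
Lemma scale_transfer_mx (R : realType) (m p r : nat)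
    (N : 'M[R]_(p, m)) (X : 'M[R]_m) (M : 'M[R]_(m, r)) :
  tofrac 'X *: transfer_mx N X M = ratmx (N *m M) + transfer_mx (N *m X) X M.
Proof.
rewrite /transfer_mx !ratmxM -mulmxDl scalemxAl; congr (_ *m _).
rewrite -mulmxA -[X in _ = X + _]mulmx1 -mulmxDr scalemxAr; congr (_ *m _).
rewrite -(mulmxV (resolvent_unit X)) mulmxBl subrK.
by rewrite mul_scalar_mx.
Qed.

(* The difference of the two sides of [N *m M = N' *m M'] is a constant equal to
   a strictly proper rational matrix, hence zero. *)
Lemma transfer_mx_eq_shift (R : realType) (m p r : nat)
    (N N' : 'M[R]_(p, m)) (X X' : 'M[R]_m) (M M' : 'M[R]_(m, r)) :
  transfer_mx N X M = transfer_mx N' X' M' ->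
  N *m M = N' *m M' /\ transfer_mx (N *m X) X M = transfer_mx (N' *m X') X' M'.
Proof.
move=> eqT; have := congr1 (fun T => tofrac 'X *: T) eqT.
rewrite /= !scale_transfer_mx => eqsT.
suff eqNM : N *m M = N' *m M'.
  by split=> //; apply: (addrI (ratmx (N *m M))); rewrite eqsT eqNM.
have [P defP szP] := transfer_mx_strictly_proper (N *m X) X M.
have [P' defP' szP'] := transfer_mx_strictly_proper (N' *m X') X' M'.
apply/matrixP => i j; apply/eqP; rewrite -subr_eq0.
set d := _ - _; apply: contraT => d_neq0.
(* Clearing both denominators: for d nonzero the left side has size 2m + 1, while the right side has
   size at most 2m. *)
have eqd : char_poly X * char_poly X' * d%:P
    = char_poly X * P' i j - char_poly X' * P i j.
  apply/eqP; rewrite -tofrac_eq; apply/eqP.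
  have /matrixP/(_ i j) eqP_ij := defP.
  have /matrixP/(_ i j) eqP'_ij := defP'.
  have /matrixP/(_ i j) eq_ij := eqsT.
  rewrite [LHS]mxE [RHS]mxE in eqP_ij; rewrite [LHS]mxE [RHS]mxE in eqP'_ij.
  rewrite /= mxE [RHS]mxE [X in X + _]mxE [X in _ = X + _]mxE in eq_ij.
  rewrite tofracB !tofracM -eqP_ij -eqP'_ij !mulrA.
  rewrite [_ (char_poly X') * _ (char_poly X)]mulrC -mulrBr; congr (_ * _).
  rewrite /d polyCB tofracB; apply/eqP; rewrite subr_eq addrAC eq_sym subr_eq.
  by rewrite eq_ij addrC.
have szB (Q : 'M[R]_m) (S : {poly R}) :
    (size S <= m)%N -> (size (char_poly Q * S)%R <= m + m)%N.
  move=> szS; apply: leq_trans (size_polyMleq _ _) _.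
  by rewrite size_char_poly addSn leq_add2l.
have := congr1 (fun p : {poly R} => size p) eqd.
have [chi0 chi'0] : char_poly X != 0 /\ char_poly X' != 0.
  by split; apply/monic_neq0/char_poly_monic.
rewrite /= mulrC mul_polyC size_scale // size_mul // !size_char_poly addnS /=.
move=> sz_eq; suff: ((m + m).+1 <= m + m)%N by rewrite ltnn.
rewrite -addSn sz_eq; apply: leq_trans (size_polyD _ _) _.
by rewrite size_polyN geq_max !szB.
Qed.

(** Each step absorbs a factor [X] into [N] and [X'] into [N'], so the induction needs two different
    output matrices even when it starts from equal ones. *)
Lemma transfer_mx_markov (R : realType) (m p r : nat)
    (N N' : 'M[R]_(p, m)) (X X' : 'M[R]_m) (M M' : 'M[R]_(m, r)) :
  transfer_mx N X M = transfer_mx N' X' M' ->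
  forall k, N *m X ^+ k *m M = N' *m X' ^+ k *m M'.
Proof.
move=> eqT k; elim: k N N' eqT => [|k IHk] N N' /transfer_mx_eq_shift[eqNM eqT].
  by rewrite !expr0 !mulmx1.
by rewrite !exprS -!mulmxE !mulmxA; apply: IHk.
Qed.

(** * Kronecker products: from extended to plain Markov parameters *)

Section TensorBilinear.
Variables (R : comNzRingType) (m n p q : nat).
Implicit Types (Y : 'M[R]_(m, n)) (Z : 'M[R]_(p, q)).

Lemma tensmxDr Y Z Z' : Y *t (Z + Z') = Y *t Z + Y *t Z'.
Proof. by apply/matrixP => i j; rewrite !mxE mulrDr. Qed.

Lemma tensmxBl Y Y' Z : (Y - Y') *t Z = Y *t Z - Y' *t Z.
Proof. by apply/matrixP => i j; rewrite !mxE mulrBl. Qed.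

End TensorBilinear.

Lemma tensmx_eq0 (F : fieldType) (m n p q : nat)
    (Y : 'M[F]_(m, n)) (Z : 'M[F]_(p, q)) :
  Z != 0 -> Y *t Z = 0 -> Y = 0.
Proof.
move=> /matrix0Pn[k [l Zkl]] YZ0; apply/matrixP => i j; rewrite mxE.
have /matrixP/(_ (mxtens_index (i, k)) (mxtens_index (j, l))) := YZ0.
by rewrite /= tensmxE mxE => /eqP; rewrite mulf_eq0 (negPf Zkl) orbF => /eqP.
Qed.

(* [S j] is the sum of the words with [j] letters [F] and [k - j] letters [A]; it
   is essential that it does not depend on [X]. *)
Lemma tensmx_exp_expansion (R : comNzRingType) (n q : nat) (A F : 'M[R]_q) k :
  exists2 S : nat -> 'M[R]_q, S k = F ^+ k &
    forall X : 'M[R]_n,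
      (1%:M *t A + X *t F) ^+ k = \sum_(j < k.+1) X ^+ j *t S j.
Proof.
elim: k => [|k [S Sk IHk]].
  exists (fun _ => 1) => // X; rewrite big_ord1 !expr0.
  apply/matrixP => i j; rewrite -[i]mxtens_unindexK -[j]mxtens_unindexK tensmxE.
  by rewrite !mxE (can_eq (@mxtens_indexK _ _)) -natrM mulnb.
(* Words are split by their leftmost letter. The guard discards [S k.+1], a junk value: only [S 0],
   ..., [S k] are meaningful. *)
pose S' j := (if (j <= k)%N then A *m S j else 0)
  + (if j is j'.+1 then F *m S j' else 0).
exists S' => [|X]; first by rewrite /S' ltnn add0r Sk exprS.
rewrite exprS IHk mulr_sumr.
under [RHS]eq_bigr do rewrite tensmxDr.
rewrite [RHS]big_split /= [X in _ = X + _]big_ord_recr /= ltnn tensmx0 addr0.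
rewrite [X in _ = _ + X]big_ord_recl tensmx0 add0r -big_split /=.
apply: eq_bigr => j _; rewrite -mulmxE mulmxDl !tensmx_mul mul1mx.
by rewrite -ltnS ltn_ord exprS mulmxE.
Qed.

Lemma markov_tens (R : realType) (n q r t a b : nat)
    (A F : 'M[R]_q) (B : 'M[R]_(q, r)) (C : 'M[R]_(t, q))
    (M : 'M[R]_(n, a)) (N : 'M[R]_(b, n)) (X Y : 'M[R]_n) :
  (forall k, (1 <= k)%N -> C *m F ^+ k *m B != 0) ->
  (forall k, (N *t C) *m (1%:M *t A + X *t F) ^+ k *m (M *t B)
           = (N *t C) *m (1%:M *t A + Y *t F) ^+ k *m (M *t B)) ->
  forall k, N *m X ^+ k *m M = N *m Y ^+ k *m M.
Proof.
move=> nzCFB eqXY k; have [h] := ubnP k; elim: h k => // h IHh k; rewrite ltnS => le_k_h.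
case: k le_k_h => [|k] le_k_h; first by rewrite !expr0.
have [S Sk expE] := tensmx_exp_expansion n A F k.+1.
have := eqXY k.+1; rewrite !expE !mulmx_sumr !mulmx_suml.
rewrite big_ord_recr [in RHS]big_ord_recr /= Sk !tensmx_mul.
(* The terms of lower degree agree by induction because [S] is common to [X] and [Y]; only the top
   term, with right factor C F^(k+1) B, remains. *)
have -> : \sum_(i < k.+1) N *t C *m (X ^+ i *t S i) *m (M *t B)
        = \sum_(i < k.+1) N *t C *m (Y ^+ i *t S i) *m (M *t B).
  apply: eq_bigr => i _; rewrite !tensmx_mul IHh //.
  exact: leq_trans (ltn_ord i) le_k_h.
move/addrI/eqP; rewrite -subr_eq0 -tensmxBl => /eqP /(tensmx_eq0 (nzCFB _ _)).
by move=> /(_ isT) /eqP; rewrite subr_eq0 => /eqP.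
Qed.

(** * Propagation along zero forcing *)

(** All powers are carried along, since a force obtains the new entries of the k-th power from known
    entries of the (k+1)-st. *)
Definition agree_on (R : realType) (n : nat) (X Y : 'M[R]_n) (Z : {set 'I_n}) :=
  forall k, {in Z &, forall i j, (X ^+ k) i j = (Y ^+ k) i j}.

Lemma Pmx_entry (R : realType) (n : nat) (VI VO : {set 'I_n}) (T : 'M[R]_n)
    (i : 'I_#|VO|) (j : 'I_#|VI|) :
  ((Pmx R VO)^T *m T *m Pmx R VI) i j = T (enum_val i) (enum_val j).
Proof.
rewrite mxE (bigD1 (enum_val j)) //= big1 ?addr0; last first.
  by move=> l /negPf nl; rewrite [Pmx _ _ _ _]mxE nl mulr0.
rewrite [Pmx _ _ _ _]mxE eqxx mulr1 mxE (bigD1 (enum_val i)) //= big1 ?addr0.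
  by rewrite !mxE eqxx mul1r.
by move=> l /negPf nl; rewrite !mxE nl mul0r.
Qed.

Lemma symmx_exp (R : comNzRingType) (n : nat) (X : 'M[R]_n) k :
  X^T = X -> (X ^+ k)^T = X ^+ k.
Proof.
move=> symX; elim: k => [|k IHk]; first by rewrite expr0 trmx1.
by rewrite exprS -mulmxE trmx_mul IHk symX mulmxE -exprSr exprS.
Qed.

Section ForcingStep.
Variables (R : realType) (n : nat) (G : sgraph 'I_n) (X Y : 'M[R]_n).
Hypotheses (QX : Qp G X) (QY : Qp G Y).
Variables (Z : {set 'I_n}) (u v : 'I_n).
Hypotheses (XY : agree_on X Y Z) (uv : forces G Z u v).

(** Apart from [v], white vertices are not adjacent to [u] and contribute 0; the arbitrary diagonal
    entry falls in the sum over [Z], as [u] is black. *)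
Lemma forces_row (X' : 'M[R]_n) (p : nat) (T : 'M[R]_(n, p)) j : Qp G X' ->
  (X' *m T) u j = \sum_(w in Z) X' u w * T w j + X' u v * T v j.
Proof.
move=> QX'; have [symX' zX'] := QX'; have /andP[uZ /eqP Euv] := uv.
have : v \in [set w | G u w & w \notin Z] by rewrite Euv set11.
rewrite inE => /andP[Guv vZ].
rewrite mxE (bigID (mem Z)) /=; congr (_ + _).
rewrite (bigD1 v) //= big1 ?addr0 // => w /andP[wZ wv].
have : w \notin [set w | G u w & w \notin Z] by rewrite Euv inE.
rewrite inE wZ andbT => nGuw.
have uw : u != w by apply: contraNneq wZ => <-.
by rewrite -symX' mxE (proj2 (zX' _ _ uw) nGuw) mul0r.
Qed.

Lemma agree_on_forced : agree_on X Y (v |: Z).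
Proof.
have /andP[uZ /eqP Euv] := uv.
have vZ : v \notin Z.
  by have := set11 v; rewrite -Euv inE => /andP[].
have Guv : G u v by have := set11 v; rewrite -Euv inE => /andP[].
have [symX zX] := QX; have [symY zY] := QY.
have nuv : u != v by apply: contraNneq vZ => <-.
have XE k i j : (X ^+ k) i j = (X ^+ k) j i by rewrite -[in LHS](symmx_exp k symX) mxE.
have YE k i j : (Y ^+ k) i j = (Y ^+ k) j i by rewrite -[in LHS](symmx_exp k symY) mxE.
have Xuv : 0 < X u v by rewrite -symX mxE; case: (zX _ _ nuv) => + _; apply.
have Yuv : 0 < Y u v by rewrite -symY mxE; case: (zY _ _ nuv) => + _; apply.
have XYZ : {in Z &, forall i j, X i j = Y i j} by have := XY 1; rewrite !expr1.
have step_row k j : (X ^+ k.+1) u j = (Y ^+ k.+1) u j ->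
    {in Z, forall w, (X ^+ k) w j = (Y ^+ k) w j} ->
    X u v * (X ^+ k) v j = Y u v * (Y ^+ k) v j.
  move=> eq1 eqw; move: eq1.
  rewrite !exprS -!mulmxE (forces_row _ _ QX) (forces_row _ _ QY).
  have -> : \sum_(w in Z) X u w * (X ^+ k) w j = \sum_(w in Z) Y u w * (Y ^+ k) w j.
    by apply: eq_bigr => w wZ; rewrite XYZ // eqw.
  exact: addrI.
have eq_vZ k j : j \in Z -> X u v * (X ^+ k) v j = Y u v * (Y ^+ k) v j.
  by move=> jZ; apply: step_row => [|w wZ]; apply: XY.
have sq : X u v * X u v = Y u v * Y u v.
  by have := eq_vZ 1 u uZ; rewrite !expr1 -{2}symX -{2}symY !mxE.
have eq_uv : X u v = Y u v.
  by apply/eqP; rewrite -(@eqrXn2 _ 2) ?ltW // !expr2 sq.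
have eq_v k : {in Z, forall j, (X ^+ k) v j = (Y ^+ k) v j}.
  move=> j jZ; have := eq_vZ k j jZ; rewrite eq_uv.
  by move/mulfI; apply; rewrite gt_eqF.
(* Now j = v: the entries of column [v] in black rows, including row [u] of the (k+1)-st power, are
   known from [eq_v] by symmetry. *)
have eq_vv k : (X ^+ k) v v = (Y ^+ k) v v.
  have : Y u v * (X ^+ k) v v = Y u v * (Y ^+ k) v v.
    rewrite -{1}eq_uv; apply: step_row; first by rewrite XE YE eq_v.
    by move=> w wZ; rewrite XE YE eq_v.
  by move/mulfI; apply; rewrite gt_eqF.
move=> k i j; rewrite !in_setU1 => /predU1P[->|iZ] /predU1P[->|jZ] //.
- exact: eq_v.
- by rewrite XE YE eq_v.
- exact: XY.
Qed.

End ForcingStep.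

Lemma agree_on_derived (R : realType) (n : nat) (G : sgraph 'I_n) (X Y : 'M[R]_n)
    (Z D : {set 'I_n}) :
  Qp G X -> Qp G Y -> connect (color_change G) Z D ->
  agree_on X Y Z -> agree_on X Y D.
Proof.
move=> QX QY /connectP[s + ->]; elim: s Z => //= Z' s IHs Z /andP[step pathZ'] XY.
apply: IHs pathZ' _.
have /existsP[u /existsP[v /andP[uv /eqP ->]]] := step.
exact: (agree_on_forced QX QY XY uv).
Qed.

Theorem theorem4 (R : realType) (n q r t sigma : nat)
    (G : sgraph 'I_n) (GS : induced_subgraph G) (VI VO : {set 'I_n})
    (A : 'M[R]_q) (B : 'M[R]_(q, r)) (C : 'M[R]_(t, q))
    (E : 'M[R]_(q, sigma)) (K : 'M[R]_(sigma, q))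
    (DW : {set 'I_n})
    (hDW : is_derived_set G (VI :&: VO) DW)
    (hVS : sub_vertices GS \subset DW)
    (hCEKB : forall k : nat, (1 <= k)%N -> C *m (E *m K) ^+ k *m B != 0) :
  identifiable A B C E K GS VI VO.
Proof.
move=> X Y QX QY /transfer_mx_markov /(markov_tens hCEKB) eqXY.
(* A vertex of the intersection serves both as an output row and as an input column. *)
have XY : agree_on X Y (VI :&: VO).
  move=> k i j /setIP[_ iO] /setIP[jI _].
  have /matrixP/(_ (enum_rank_in iO i) (enum_rank_in jI j)) := eqXY k.
  by rewrite /= !Pmx_entry !enum_rankK_in.
have := agree_on_derived QX QY (proj1 hDW) XY.
move=> /(_ 1); rewrite !expr1 => eqD.
apply/matrixP => i j; rewrite !mxE.
by apply: eqD; apply: (subsetP hVS); apply: enum_valP.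
Qed.
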